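(* Let $f:\mathbb{R}^n\to(-\infty,+\infty]$ be proper, lower semicontinuous and prox-bounded with threshold $\lambda_f>0$, and let $0<\mu<\lambda_f$. Then the following are equivalent: (a) the proximal mapping $\operatorname{Prox}_{\mu}f$ is single-valued, i.e., $\operatorname{Prox}_{\mu}f(x)$ is a singleton for every $x\in\mathbb{R}^n$; (b) the function $f+\frac{1}{2\mu}\|\cdot\|^2$ is essentially strictly convex and coercive.
   Context: $\|\cdot\|$ is the Euclidean norm. For a proper function $f$ and $\mu>0$, $e_{\mu}f(x)=\inf_{w}\{f(w)+\frac{1}{2\mu}\|w-x\|^2\}$ and $\operatorname{Prox}_{\mu}f(x)=\operatorname{argmin}_{w}\{f(w)+\frac{1}{2\mu}\|w-x\|^2\}$. $f$ is prox-bounded if there exist $\lambda>0$ and $x$ with $e_{\lambda}f(x)>-\infty$; the supremum $\lambda_f\in(0,+\infty]$ of all such $\lambda$ is its threshold. A proper, lower semicontinuous, convex function $h$ is essentially strictly convex if $h$ is strictly convex on every convex subset of $\operatorname{dom}\partial h=\{x:\partial h(x)\neq\varnothing\}$, where $\partial h(x)=\{s: h(y)\ge h(x)+\langle s,y-x\rangle\ \forall y\}$ (so essential strict convexity includes convexity). A function $h$ is coercive if $\liminf_{\|x\|\to\infty}h(x)/\|x\|=\infty$. *)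

(* Defs.v *)
From HB Require Import structures.
From mathcomp Require Import all_boot all_order all_algebra.
From mathcomp Require Import all_classical all_reals all_analysis.

Set Implicit Arguments.
Unset Strict Implicit.
Unset Printing Implicit Defensive.

Import Order.TTheory GRing.Theory Num.Theory.
Import numFieldNormedType.Exports.

Local Open Scope classical_set_scope.
Local Open Scope ring_scope.

Section ProxDefs.
Context {R : realType} {n : nat}.
Implicit Types (f g h : 'rV[R]_n -> \bar R) (x y s w : 'rV[R]_n).
Implicit Types (C : set 'rV[R]_n) (mu lambda t : R).

(* The library norm on matrices is the sup norm, hence the following. The
   topology on 'rV[R]_n is the product topology, i.e. the Euclidean one. *)
Definition dotv x y : R := \sum_(i < n) x ord0 i * y ord0 i.

Definition enorm x : R := Num.sqrt (dotv x x).

Definition proper_fun f : Prop :=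
  (forall x, (-oo < f x)%E) /\ (exists x, (f x < +oo)%E).

Definition prox_objective mu f x w : \bar R :=
  (f w + ((2 * mu)^-1 * enorm (w - x) ^+ 2)%:E)%E.

Definition moreau_env mu f x : \bar R :=
  ereal_inf (range (prox_objective mu f x)).

Definition argmin g : set 'rV[R]_n := [set w | forall v, (g w <= g v)%E].

Definition Prox mu f x : set 'rV[R]_n := argmin (prox_objective mu f x).

Definition prox_params f : set R :=
  [set lambda | 0 < lambda /\ exists x, (-oo < moreau_env lambda f x)%E].

Definition prox_bounded f : Prop := prox_params f !=set0.

Definition prox_threshold f : \bar R := ereal_sup (EFin @` prox_params f).

Definition single_valued (P : 'rV[R]_n -> set 'rV[R]_n) : Prop :=
  forall x, exists p, P x = [set p].

(* Used only for functions > -oo, so that no indeterminate sum -oo + +oo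
   occurs on the right-hand side. *)
Definition convex_fun h : Prop :=
  forall x y t, 0 < t -> t < 1 ->
    (h (t *: x + (1 - t) *: y)%R <= t%:E * h x + (1 - t)%:E * h y)%E.

Definition strictly_convex_on C h : Prop :=
  forall x y t, C x -> C y -> x <> y -> 0 < t -> t < 1 ->
    (h (t *: x + (1 - t) *: y)%R < t%:E * h x + (1 - t)%:E * h y)%E.

Definition subdiff h x : set 'rV[R]_n :=
  [set s | forall y, (h x + (dotv s (y - x))%:E <= h y)%E].

Definition dom_subdiff h : set 'rV[R]_n := [set x | subdiff h x !=set0].

Definition essentially_strictly_convex h : Prop :=
  [/\ proper_fun h, lower_semicontinuous h, convex_fun h &
      forall C, convex_set C -> C `<=` dom_subdiff h ->
        strictly_convex_on C h].

(* The filter "||x|| --> +oo". *)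
Definition enorm_infty : set_system 'rV[R]_n :=
  [set V | exists M : R, forall x, M < enorm x -> V x].

Definition coercive h : Prop :=
  limf_einf (fun x => h x * ((enorm x)^-1)%:E)%E enorm_infty = +oo%E.

End ProxDefs.

(* Main.v *)
(* Let h = f + |.|^2 / (2 mu).  Completing the square, Prox_mu f (mu v) is the
   set of minimizers of the tilted function h - <v, .>.  As mu < lambda_f, h
   grows at least quadratically, so that h is coercive and every tilted function
   has a minimizer; only uniqueness is at stake.

   If h is convex and essentially strictly convex, the minimizers of
   h - <v, .> form a convex subset of dom (subdiff h), hence a single point.

   Conversely, let p v be the unique minimizer of h - <v, .>, and let g be the
   conjugate of h.  Then g is a finite function differentiable with gradient p,
   so for z and eps > 0 the minimizer v of g - <., z> + (eps / 2) |.|^2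
   satisfies p v = z - eps v.  For z = t x + (1 - t) y, averaging the subgradient
   inequality h >= h (p v) + <v, . - p v> at x and y yields
   t h x + (1 - t) h y >= h (p v) + eps |v|^2.  When eps tends to 0, p v tends
   to z, and lower semicontinuity gives the convexity of h.  Equality in the
   convexity inequality at a point z with subgradient s would make both x and y
   minimizers of h - <s, .>. *)
Require Import Defs.
From HB Require Import structures.
From mathcomp Require Import all_boot all_order all_algebra.
From mathcomp Require Import all_classical all_reals all_analysis.
From mathcomp Require Import ring lra.

Set Implicit Arguments.
Unset Strict Implicit.
Unset Printing Implicit Defensive.

Import Order.TTheory GRing.Theory Num.Theory.
Import numFieldNormedType.Exports.

Local Open Scope classical_set_scope.
Local Open Scope ring_scope.

(** * Euclidean inner product, and its link with the product topology *)

Section Dotv.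
Context {R : realType} {n : nat}.
Implicit Types (x y z : 'rV[R]_n) (a : R).

Lemma dotvC x y : dotv x y = dotv y x.
Proof. by apply: eq_bigr => i _; rewrite mulrC. Qed.

Lemma dotvDl x y z : dotv (x + y) z = dotv x z + dotv y z.
Proof.
by rewrite /dotv -big_split; apply: eq_bigr => i _; rewrite !mxE mulrDl.
Qed.

Lemma dotvZl a x y : dotv (a *: x) y = a * dotv x y.
Proof.
by rewrite /dotv mulr_sumr; apply: eq_bigr => i _; rewrite !mxE mulrA.
Qed.

Lemma dotvNl x y : dotv (- x) y = - dotv x y.
Proof. by rewrite -scaleN1r dotvZl mulN1r. Qed.

Lemma dotvDr x y z : dotv x (y + z) = dotv x y + dotv x z.
Proof. by rewrite dotvC dotvDl !(dotvC x). Qed.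

Lemma dotvZr a x y : dotv x (a *: y) = a * dotv x y.
Proof. by rewrite dotvC dotvZl (dotvC x). Qed.

Lemma dotvNr x y : dotv x (- y) = - dotv x y.
Proof. by rewrite dotvC dotvNl (dotvC x). Qed.

Definition dotvE := (dotvDl, dotvDr, dotvNl, dotvNr, dotvZl, dotvZr).

Lemma sqr_coord_le x i : x ord0 i ^+ 2 <= dotv x x.
Proof.
rewrite /dotv (bigD1 i) //= expr2 lerDl.
by apply: sumr_ge0 => j _; rewrite -expr2 sqr_ge0.
Qed.

Lemma dotvv_ge0 x : 0 <= dotv x x.
Proof. by apply: sumr_ge0 => i _; rewrite -expr2 sqr_ge0. Qed.

Lemma dotvv_le0 x : dotv x x <= 0 -> x = 0.
Proof.
move=> x0; apply/rowP => i; rewrite mxE; apply/eqP.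
by rewrite -sqrf_eq0 eq_le sqr_ge0 (le_trans (sqr_coord_le x i) x0).
Qed.

Lemma sqr_enorm x : enorm x ^+ 2 = dotv x x.
Proof. by rewrite sqr_sqrtr // dotvv_ge0. Qed.

(** Expansion of [|a x - y|^2 >= 0], divided by [2 a]. It serves to absorb linear terms into a
    fraction of a quadratic one. *)
Lemma dotv_young a x y : 0 < a ->
  dotv x y <= a / 2 * dotv x x + (2 * a)^-1 * dotv y y.
Proof.
move=> a0; have := dotvv_ge0 (a *: x - y).
rewrite !dotvE (dotvC y x) => H; rewrite -subr_ge0.
have -> : a / 2 * dotv x x + (2 * a)^-1 * dotv y y - dotv x y =
    (2 * a)^-1 * (a * (a * dotv x x) - a * dotv x y
                  + (- (a * dotv x y) - - dotv y y)).
  by field; rewrite gt_eqF.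
by apply: mulr_ge0; [rewrite invr_ge0; lra|lra].
Qed.

Lemma dotv_sumsq_le x y : dotv (x + y) (x + y) <= 2 * dotv x x + 2 * dotv y y.
Proof.
by have := dotvv_ge0 (x - y); rewrite !dotvE (dotvC y x); lra.
Qed.

Lemma continuous_dotv x : continuous (dotv x).
Proof.
apply: (@continuous_big R _ _ _ _ (@add_continuous R)) => i _ y.
by apply: (@cvgM _ _ (nbhs y)); [exact: cvg_cst|exact: coord_continuous].
Qed.

Lemma continuous_dotvv : continuous (fun x : 'rV[R]_n => dotv x x).
Proof.
apply: (@continuous_big R _ _ _ _ (@add_continuous R)) => i _ y.
by apply: (@cvgM _ _ (nbhs y)); exact: coord_continuous.
Qed.

(** Each coordinate of [x - z] is at most its Euclidean norm, so a sup-norm ball contains the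
    Euclidean ball of the same radius. *)
Lemma nbhs_sqdist z (V : set 'rV[R]_n) : nbhs z V ->
  exists2 d, 0 < d & forall x, dotv (x - z) (x - z) < d -> V x.
Proof.
move=> /nbhs_ballP[e /= e0 eV]; exists (e ^+ 2); first by rewrite exprn_gt0.
move=> x xz; apply: eV; split => // i j; rewrite (ord1 i) -ball_normE /=.
rewrite distrC -(@ltr_pXn2r _ 2) ?nnegrE ?(ltW e0)//.
rewrite real_normK ?num_real//; apply: le_lt_trans xz.
by have := sqr_coord_le (x - z) j; rewrite !mxE.
Qed.

Lemma compact_dotvv_le a : compact [set x : 'rV[R]_n | dotv x x <= a].
Proof.
apply: bounded_closed_compact.
- exists (1 + `|a|); split; first exact: num_real.
  move=> b ab x /= xa; rewrite [leLHS]/Num.norm /= mx_normrE.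
  have b0 : 0 <= b by move: (normr_ge0 a); lra.
  apply/bigmax_leP; split => // -[i j] _ /=; rewrite (ord1 i).
  rewrite -(@ler_pXn2r _ 2) ?nnegrE// real_normK ?num_real//.
  apply: le_trans (sqr_coord_le _ _) _; apply: le_trans xa _.
  by move: (ler_norm a); nra.
- apply: (@closed_comp _ _ (fun x => dotv x x) [set y | y <= a]).
    by move=> x _; exact: continuous_dotvv.
  exact: closed_le.
Qed.

End Dotv.

(** * Lower semicontinuity and existence of minimizers *)

Section LowerSemicontinuity.
Context {R : realType}.

Lemma lower_semicontinuousD {X : topologicalType} (h : X -> \bar R)
    (g : X -> R) : lower_semicontinuous h -> continuous g ->
  lower_semicontinuous (fun x => h x + (g x)%:E)%E.
Proof.
move=> hl gc x a ax.
(* The level [a] is split as [b + (a - b)], with [b] strictly below [h x] and [a - b] strictly below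
   [g x]. *)
have [b [bh ab]] : exists b, (b%:E < h x)%E /\ a - b < g x.
  move: ax; case: (h x) => [r| |]//=.
    rewrite -EFinD lte_fin => ax; exists ((r + (a - g x)) / 2).
    by rewrite lte_fin; split; lra.
  by move=> _; exists (a - g x + 1); rewrite ltry; split => //; lra.
have [V xV Vb] := hl _ _ bh.
exists (V `&` [set y | a - b < g y]).
  apply: filterI => //; exact: (gc x _ (lt_nbhsr ab)).
move=> y [/Vb + /=].
case: (h y) => [r| |]//= br abg; last by rewrite addye ?ltry.
by rewrite -EFinD lte_fin; move: br; rewrite lte_fin; lra.
Qed.

Lemma lower_semicontinuous_EFin {X : topologicalType} (g : X -> R) :
  continuous g -> lower_semicontinuous (fun x => (g x)%:E).
Proof.
move=> gc x a; rewrite lte_fin => ag; exists [set y | a < g y] => //.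
exact: (gc x _ (lt_nbhsr ag)).
Qed.

Lemma lower_semicontinuous_cluster {X : topologicalType} (h : X -> \bar R)
    (F : set_system X) (x : X) (b : R) : lower_semicontinuous h ->
  cluster F x -> (forall e, 0 < e -> F [set y | h y < (b + e)%:E]%E) ->
  (h x <= b%:E)%E.
Proof.
move=> hl Fx Fb; rewrite leNgt; apply/negP => bh.
have [c [ch bc]] : exists c, (c%:E < h x)%E /\ b < c.
  move: bh; case: (h x) => [r| |]//=.
    rewrite lte_fin => br; exists ((r + b) / 2).
    by rewrite lte_fin; split; lra.
  by move=> _; exists (b + 1); rewrite ltry; split => //; lra.
have [V xV Vc] := hl _ _ ch.
have [|y [/= hy /Vc]] := Fx _ _ (Fb (c - b) _) xV; first by rewrite subr_gt0.
by rewrite subrKC in hy; move/(lt_trans hy); rewrite ltxx.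
Qed.

(** Direct method: the sublevel sets just above the infimum generate a proper filter. Growth
    confines it to a compact ball, and a cluster point attains the infimum by lower
    semicontinuity. *)
Lemma growth_argmin {n} (h : 'rV[R]_n -> \bar R) (a C : R) :
  lower_semicontinuous h -> (exists x, (h x < +oo)%E) -> 0 < a ->
  (forall x, ((a * dotv x x - C)%:E <= h x)%E) -> argmin h !=set0.
Proof.
move=> hl [w0 hw0] a0 hg.
pose m := ereal_inf (range h).
have mfin : m \is a fin_num.
  rewrite fin_real//; apply/andP; split.
    apply: (@lt_le_trans _ _ (- C)%:E); first exact: ltNyr.
    apply/ereal_infP => _ [x _ <-]; apply: le_trans (hg x).
    by rewrite lee_fin; have := dotvv_ge0 x; nra.
  by apply: le_lt_trans hw0; apply: ereal_inf_lbound; exists w0.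
pose S e : set 'rV[R]_n := [set y | h y < (fine m + e)%:E]%E.
pose F := filter_from [set e : R | 0 < e] S.
have FF : ProperFilter F.
  apply: filter_from_proper; first apply: filter_from_filter.
  - by exists 1; rewrite /= ltr01.
  - move=> e1 e2 /= e10 e20; exists (Num.min e1 e2).
      by rewrite /= lt_min e10.
    by move=> y /= hy; split; apply: (lt_le_trans hy); rewrite lee_fin lerD2l
      ge_min lexx ?orbT.
  - move=> e /= e0; have [_ [y _ <-] hy] := lb_ereal_inf_adherent e0 mfin.
    by exists y; rewrite /S /= EFinD fineK.
have [|q [_ qF]] := @compact_dotvv_le R n ((fine m + 1 + C) / a) F FF.
  exists 1; rewrite /= ?ltr01// => y /= /ltW hy; rewrite ler_pdivlMr//.
  by have := le_trans (hg y) hy; rewrite lee_fin; lra.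
have : (h q <= (fine m)%:E)%E.
  by apply: lower_semicontinuous_cluster qF _ => // e e0; exists e.
rewrite fineK// => hq; exists q => w; apply: le_trans hq _.
by apply: ereal_inf_lbound; exists w.
Qed.

End LowerSemicontinuity.

(** * Linear tilts and subgradients *)

Section Tilt.
Context {R : realType} {n : nat}.
Implicit Types (h : 'rV[R]_n -> \bar R) (d u v w x y z q : 'rV[R]_n).

Definition tilt h v w : \bar R := (h w + (- dotv v w)%:E)%E.

Lemma lower_semicontinuous_tilt h v :
  lower_semicontinuous h -> lower_semicontinuous (tilt h v).
Proof.
move=> hl; apply: lower_semicontinuousD => // w.
by apply: (@cvgN _ _ _ (nbhs w)); exact: continuous_dotv.
Qed.

Lemma tilt_growth h v (a C : R) : 0 < a ->
  (forall w, ((a * dotv w w - C)%:E <= h w)%E) ->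
  forall w, ((a / 2 * dotv w w - (C + (2 * a)^-1 * dotv v v))%:E
             <= tilt h v w)%E.
Proof.
move=> a0 hg w; have := hg w; rewrite /tilt.
case: (h w) => [r| |]; rewrite ?addye ?leey//.
rewrite -EFinD !lee_fin; have := dotv_young w v a0.
by rewrite (dotvC w v); lra.
Qed.

Lemma subdiff_argmin_tilt h v w : subdiff h w v <-> argmin (tilt h v) w.
Proof.
rewrite /subdiff /argmin /tilt /=; split=> H u; have {H} := H u;
  rewrite !dotvE; case: (h w) => [r| |]; case: (h u) => [s| |];
  rewrite ?addye ?addNye ?leey ?leNye// -?EFinD ?lee_fin; lra.
Qed.

(** * Convexity from unique minimizers, through the conjugate *)

Section UniqueMinimizers.
Variables (h : 'rV[R]_n -> \bar R) (a C : R) (p : 'rV[R]_n -> 'rV[R]_n).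
Hypotheses (h_lsc : lower_semicontinuous h) (h_proper : proper_fun h).
Hypothesis a_gt0 : 0 < a.
Hypothesis h_growth : forall w, ((a * dotv w w - C)%:E <= h w)%E.
Hypothesis p_argmin : forall v, argmin (tilt h v) = [set p v].

(* The conjugate of [h]. *)
Let g v : R := dotv v (p v) - fine (h (p v)).

Let h_p v : h (p v) = (dotv v (p v) - g v)%:E.
Proof.
have [w0 hw0] := h_proper.2.
have /(_ w0) : argmin (tilt h v) (p v) by rewrite p_argmin.
rewrite /g subKr /tilt; move: hw0; case: (h w0) => // [r| ] _.
  by have := h_proper.1 (p v); case: (h (p v)).
by have := h_proper.1 (p v); case: (h (p v)).
Qed.

Let fenchel v w : ((dotv v w - g v)%:E <= h w)%E.
Proof.
have /(_ w) : argmin (tilt h v) (p v) by rewrite p_argmin.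
rewrite /tilt h_p; case: (h w) => [r| |]; rewrite ?addye ?leey//.
by rewrite -!EFinD !lee_fin; lra.
Qed.

(** The Fenchel inequality for the slope [u] at the point [p v], where the slope [v] gives equality:
    [p v] is a subgradient of the conjugate at [v]. *)
Let g_subgradient v u : g v + dotv (u - v) (p v) <= g u.
Proof.
by have := fenchel u (p v); rewrite h_p lee_fin !dotvE; lra.
Qed.

Let p_unique v q : (h q <= (dotv v q - g v)%:E)%E -> q = p v.
Proof.
move=> hq; suff : argmin (tilt h v) q by rewrite p_argmin.
move=> w; apply: le_trans (_ : (tilt h v q <= (- g v)%:E)%E) _.
  move: hq; rewrite /tilt.
  by case: (h q) => [r| |]; rewrite ?addNye ?leNye// -EFinD !lee_fin; lra.
have := fenchel v w; rewrite /tilt.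
case: (h w) => [r| |]; rewrite ?addye ?leey//.
by rewrite -EFinD !lee_fin; lra.
Qed.

(** The growth of [h] at [p v] gives [a |p v|^2 - C <= <v, p v> - g v]. The subgradient of [g] at 0
    bounds [g v] from below, and Young's inequality absorbs [<v, p v>]. *)
Let p_bounded B : exists M, forall v, dotv v v <= B -> dotv (p v) (p v) <= M.
Proof.
pose D := C - g 0 + B / 2 + dotv (p 0) (p 0) / 2 + (2 * a)^-1 * B.
exists (2 * D / a) => v vB; rewrite ler_pdivlMr//.
have := h_growth (p v); rewrite h_p lee_fin.
have := g_subgradient 0 v; rewrite subr0.
have := dotv_young (p v) v a_gt0; rewrite (dotvC (p v) v).
have := dotv_young (- v) (p 0) ltr01; rewrite !dotvE.
have : (2 * a)^-1 * dotv v v <= (2 * a)^-1 * B.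
  by rewrite ler_wpM2l// invr_ge0 mulr_ge0 ?ltW.
by rewrite /D; lra.
Qed.

(* Replaces the continuity of [p]: by lower semicontinuity, a cluster point of
   [p (v + s d)] minimizes [tilt h v], so it is [p v]. *)
Let p_directional v d (b : R) :
  (forall e : R, 0 < e ->
     \forall s \near 0^'+, b - e < dotv (p (v + s *: d)) d) ->
  b <= dotv (p v) d.
Proof.
move=> hb; pose F := (fun s => p (v + s *: d)) @ 0^'+.
have [M hM] := p_bounded (2 * dotv v v + 2 * dotv d d).
have FM : F [set w | dotv w w <= M].
  rewrite /F /=; near=> s; apply: hM; apply: le_trans (dotv_sumsq_le _ _) _.
  have s0 : 0 < s by [].
  have s1 : s < 1 by near: s; exact: nbhs_right_lt.
  rewrite !dotvE lerD2l ler_wpM2l// mulrA ler_piMl ?dotvv_ge0//.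
  by rewrite mulr_ile1 ?ltW.
have [q [_ qF]] := compact_dotvv_le _ FM.
suff -> : p v = q.
  have lscd : lower_semicontinuous (fun w => (- dotv d w)%:E).
    apply: lower_semicontinuous_EFin => w.
    by apply: (@cvgN _ _ _ (nbhs w)); exact: continuous_dotv.
  have := lower_semicontinuous_cluster lscd qF (b := - b).
  rewrite lee_fin lerN2 dotvC; apply => e e0; rewrite /F /=.
  near=> s; rewrite /= lte_fin dotvC.
  have : b - e < dotv (p (v + s *: d)) d by near: s; exact: hb.
  by lra.
apply/esym/p_unique.
suff : (tilt h v q <= (- g v)%:E)%E.
  rewrite /tilt.
  by case: (h q) => [r| |]; rewrite ?addNye ?leNye// -EFinD !lee_fin; lra.
have tilt_lsc := @lower_semicontinuous_tilt h v h_lsc.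
apply: (lower_semicontinuous_cluster tilt_lsc qF) => e e0; rewrite /F /=.
(* By [g_subgradient], [tilt h v] at [p (v + s d)] exceeds its minimum [- g v] by at most
   [s <d, p (v + s d) - p v>], and [K] bounds this inner product. *)
pose K := dotv d d + `|M| + dotv (p v) (p v).
have K0 : 0 < K + 1.
  rewrite /K; have := dotvv_ge0 d; have := dotvv_ge0 (p v).
  by have := normr_ge0 M; lra.
near=> s.
have s0 : 0 < s by [].
have M0 : dotv (p (v + s *: d)) (p (v + s *: d)) <= M.
  by near: s; exact: FM.
have sK : s * K < e.
  have : s < e / (K + 1) by near: s; apply: nbhs_right_lt; rewrite divr_gt0.
  by rewrite ltr_pdivlMr//; lra.
rewrite /= /tilt h_p -EFinD lte_fin.
have := g_subgradient v (v + s *: d).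
rewrite !dotvE.
have : s * (dotv d (p (v + s *: d)) - dotv d (p v)) <= s * K.
  rewrite ler_wpM2l ?(ltW s0)// /K.
  have := dotv_young d (p (v + s *: d)) ltr01.
  have := dotv_young d (- p v) ltr01; rewrite !dotvE.
  have := dotvv_ge0 (p v); have := ler_norm M; have := normr_ge0 M.
  by have := dotvv_ge0 d; lra.
by lra.
Unshelve. all: by end_near. Qed.

Let p_resolvent z eps : 0 < eps -> exists v, p v = z - eps *: v.
Proof.
move=> eps0.
pose phi v := g v + (- dotv z v + eps / 2 * dotv v v).
have phi_lsc : lower_semicontinuous (fun v => (phi v)%:E).
  rewrite /phi; under eq_fun do rewrite EFinD.
  apply: lower_semicontinuousD.
    move=> v b; rewrite lte_fin => bg.
    (* The affine minorant of [g] given by [p v] is continuous and touches [g] at [v], so [g] is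
       lower semicontinuous there. *)
    have gc : {for v, continuous (fun u => g v - dotv (p v) v + dotv (p v) u)}.
      by apply: (@cvgD _ _ _ (nbhs v)); [exact: cvg_cst|exact: continuous_dotv].
    exists [set u | b < g v - dotv (p v) v + dotv (p v) u].
      have bv : b < g v - dotv (p v) v + dotv (p v) v by rewrite subrK.
      exact: (gc _ (lt_nbhsr bv)).
    move=> u /= bu; rewrite lte_fin; apply: lt_le_trans bu _.
    by have := g_subgradient v u; rewrite !dotvE !(dotvC (p v)); lra.
  move=> v; apply: (@cvgD _ _ _ (nbhs v)).
    by apply: (@cvgN _ _ _ (nbhs v)); exact: continuous_dotv.
  by apply: (@cvgM _ _ (nbhs v)); [exact: cvg_cst|exact: continuous_dotvv].
have [|||v hv] := @growth_argmin R n _ (eps / 4)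
    (eps^-1 * dotv (z - p 0) (z - p 0) - g 0) phi_lsc.
- by exists 0; exact: ltry.
- by rewrite divr_gt0.
- move=> v; rewrite lee_fin /phi.
  have := g_subgradient 0 v; rewrite subr0.
  have := dotv_young v (z - p 0) (divr_gt0 eps0 (ltr0n _ 2)).
  rewrite mulrCA divff ?pnatr_eq0// mulr1 !dotvE (dotvC v z); lra.
exists v; pose r := p v - (z - eps *: v).
have rE u : dotv r u = dotv (p v) u - (dotv z u - eps * dotv v u).
  by rewrite /r !dotvE.
(* The first-order condition is tested only in the direction [- r] of the residual, where it reads
   [|r|^2 <= 0]. *)
suff : dotv z (- r) - eps * dotv v (- r) <= dotv (p v) (- r).
  rewrite !dotvNr => rN; apply/subr0_eq/dotvv_le0; rewrite -/r.
  by have := rE r; lra.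
move: (- r) => d; apply: p_directional => e e0.
have K0 : 0 < eps / 2 * dotv d d + 1.
  by rewrite ltr_wpDl// mulr_ge0 ?dotvv_ge0// divr_ge0 ?(ltW eps0).
near=> s.
have s0 : 0 < s by [].
have sK : s * (eps / 2 * dotv d d) < e.
  have : s < e / (eps / 2 * dotv d d + 1).
    by near: s; apply: nbhs_right_lt; rewrite divr_gt0.
  by rewrite ltr_pdivlMr//; lra.
(* Minimality gives [phi v <= phi (v + s d)], and the subgradient at [v + s d] bounds the increment
   of [g] by [s <p (v + s d), d>]. The factor [s] is then divided out. *)
suff : 0 <= s * (dotv (p (v + s *: d)) d - dotv z d + eps * dotv v d
                 + s * (eps / 2 * dotv d d)).
  by rewrite pmulr_rge0//; lra.
have := hv (v + s *: d); rewrite lee_fin /phi.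
have := g_subgradient (v + s *: d) v.
by rewrite !dotvE !(dotvC d) (dotvC v (p _)); lra.
Unshelve. all: by end_near. Qed.

Lemma unique_argmin_convex : convex_fun h.
Proof.
move=> x y t t0 t1; set z := t *: x + (1 - t) *: y.
have := h_proper.1 x; case Ex : (h x) => [hx| |]// _;
  have := h_proper.1 y; case Ey : (h y) => [hy| |]// _;
  rewrite ?gt0_muley ?lte_fin ?subr_gt0// ?addye ?addey ?leey//.
rewrite -!EFinM -EFinD; set A := t * hx + (1 - t) * hy.
(* The point [z - eps v] is [p v]. Averaging the Fenchel inequalities at [x] and [y] gives
   [h (p v) + eps |v|^2 <= A], and [h >= - C] then bounds [eps |v|^2] by [A + C]. *)
have key eps : 0 < eps -> exists v, (h (z - eps *: v)%R <= A%:E)%E /\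
    dotv (eps *: v) (eps *: v) <= eps * (A + C).
  move=> eps0; have [v pv] := p_resolvent z eps0.
  exists v; have hz : h (z - eps *: v) = (dotv v (z - eps *: v) - g v)%:E.
    by rewrite -pv h_p.
  have := fenchel v x; have := fenchel v y; rewrite Ex Ey !lee_fin => fy fx.
  have vA : dotv v z - g v <= A.
    by rewrite /z !dotvE /A; nra.
  have := h_growth (z - eps *: v); rewrite hz !lee_fin => hgz.
  have vz : dotv v (z - eps *: v) = dotv v z - eps * dotv v v.
    by rewrite !dotvE.
  have : eps * dotv v v <= A + C.
    have := mulr_ge0 (ltW a_gt0) (dotvv_ge0 (z - eps *: v)).
    by lra.
  have := mulr_ge0 (ltW eps0) (dotvv_ge0 v); rewrite vz dotvZl dotvZr.
  by split; [lra|rewrite ler_wpM2l// ltW].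
rewrite leNgt; apply/negP => Az.
have [V /nbhs_sqdist[d d0 dV] VA] := h_lsc Az.
have K0 : 0 < `|A + C| + 1 by rewrite ltr_wpDl.
(* This [eps] makes [eps (A + C) < d], which puts [z - eps v] in the neighbourhood where [h > A]. *)
have [|v [hv]] := key (d / (`|A + C| + 1)); first by rewrite divr_gt0.
set eps := d / _ => vd.
have /dV/VA : dotv (z - eps *: v - z) (z - eps *: v - z) < d.
  rewrite addrAC subrr add0r dotvNl dotvNr opprK; apply: le_lt_trans vd _.
  rewrite /eps -mulrA gtr_pMr// mulrC ltr_pdivrMr// mul1r.
  by have := ler_norm (A + C); lra.
by rewrite ltNge hv.
Qed.

End UniqueMinimizers.

End Tilt.

(** * Strict convexity against uniqueness, and growth of the regularized function *)

Section Minimizers.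
Context {R : realType} {n : nat}.
Implicit Types (h f : 'rV[R]_n -> \bar R) (v w x : 'rV[R]_n) (mu a : R).

Lemma convex_set_rowP (C : set 'rV[R]_n) : convex_set C <->
  forall x y t, C x -> C y -> 0 < t -> t < 1 -> C (t *: x + (1 - t) *: y).
Proof.
split=> [Cc x y t Cx Cy t0 t1|Cc].
  have := Cc x y (Itv01 (ltW t0) (ltW t1)); rewrite !in_setE; exact.
apply/convex_setW => x y; rewrite !in_setE => Cx Cy k k0 k1.
by rewrite in_setE; exact: Cc.
Qed.

Lemma unique_argmin_strict h (C : set 'rV[R]_n) : proper_fun h ->
  (forall v, exists q, argmin (tilt h v) = [set q]) ->
  convex_set C -> C `<=` dom_subdiff h -> strictly_convex_on C h.
Proof.
move=> hp hu /convex_set_rowP Cc Ch x y t Cx Cy xy t0 t1.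
set z := _ + _.
have [s /subdiff_argmin_tilt zs] := Ch _ (Cc x y t Cx Cy t0 t1).
have [w hw] := hp.2.
have hz_fin : (h z < +oo)%E.
  have := zs w; rewrite -/z /tilt; move: hw (hp.1 w).
  by case: (h w) => // r _ _; case: (h z) => [r'| |]; rewrite ?ltry ?addye.
have := hp.1 x; case Ex : (h x) => [hx| |]// _;
  have := hp.1 y; case Ey : (h y) => [hy| |]// _;
  rewrite ?gt0_muley ?lte_fin ?subr_gt0// ?addye ?addey//.
move: hz_fin (hp.1 z); case Ez : (h z) => [hz| |]// _ _.
rewrite -!EFinM -EFinD lte_fin ltNge; apply/negP => le_z.
have zx := zs x; have zy := zs y.
rewrite -/z /tilt Ex Ey Ez -!EFinD !lee_fin in zx zy.
have sz : dotv s z = t * dotv s x + (1 - t) * dotv s y by rewrite /z !dotvE.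
(* As [z] minimizes [h - <s, .>] and the average of its values at [x] and [y] is at most the value
   at [z], neither of them can exceed that value. *)
have xz : hx - dotv s x <= hz - dotv s z by nra.
have yz : hy - dotv s y <= hz - dotv s z by nra.
have [q hq] := hu s; apply: xy; transitivity q.
  suff : argmin (tilt h s) x by rewrite hq.
  by move=> u; apply: le_trans (zs u); rewrite -/z /tilt Ex Ez lee_fin.
suff : argmin (tilt h s) y by rewrite hq.
by move=> u; apply: le_trans (zs u); rewrite -/z /tilt Ey Ez lee_fin.
Qed.

Lemma argmin_tilt_unique h v p q : essentially_strictly_convex h ->
  argmin (tilt h v) p -> argmin (tilt h v) q -> p = q.
Proof.
move=> [hp _ hc hs] vp vq; apply: contrapT => pq.
have [w hw] := hp.2.
have fin u : argmin (tilt h v) u -> (h u < +oo)%E.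
  move=> /(_ w); rewrite /tilt; move: hw (hp.1 w).
  by case: (h w) => // r _ _; case: (h u) => [r'| |]; rewrite ?ltry ?addye.
have cvx : convex_set (argmin (tilt h v)).
  apply/convex_set_rowP => x y t vx vy t0 t1 u; set z := _ + _.
  have := hc x y t t0 t1; have := vx u; have := vy u.
  move: (fin _ vx) (hp.1 x) (fin _ vy) (hp.1 y); rewrite /tilt.
  case: (h x) => [hx| |]// _ _; case: (h y) => [hy| |]// _ _.
  rewrite -!EFinM -!EFinD; case: (h z) => [hz| |]; case: (h u) => [r| |];
    rewrite ?addye ?addNye ?leey ?leNye// -?EFinD ?lee_fin//.
  by rewrite /z !dotvE => *; nra.
have sub : argmin (tilt h v) `<=` dom_subdiff h.
  by move=> x vx; exists v; exact/subdiff_argmin_tilt.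
(* At the midpoint of two distinct minimizers, strict convexity would give a value below the
   minimum. *)
have := hs _ cvx sub p q 2^-1 vp vq pq; set z := _ + _.
rewrite invr_gt0 ltr0n invf_lt1// ltr1n => /(_ isT isT).
have := vp z; have := vq z; have := vq p; rewrite /tilt.
move: (fin _ vp) (hp.1 p) (fin _ vq) (hp.1 q).
case: (h p) => [hx| |]// _ _; case: (h q) => [hy| |]// _ _.
rewrite -!EFinM -!EFinD; case: (h z) => [hz| |]//.
rewrite -!EFinD !lee_fin lte_fin /z !dotvE; lra.
Qed.

Lemma prox_argmin f mu v : 0 < mu ->
  Prox mu f (mu *: v) =
  argmin (tilt (fun x => f x + ((2 * mu)^-1 * enorm x ^+ 2)%:E)%E v).
Proof.
move=> mu0.
have E w : prox_objective mu f (mu *: v) w =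
    (tilt (fun x => f x + ((2 * mu)^-1 * enorm x ^+ 2)%:E) v w
     + (mu / 2 * dotv v v)%:E)%E.
  rewrite /prox_objective /tilt !sqr_enorm -!addeA; congr (_ + _)%E.
  rewrite -!EFinD; congr _%:E; rewrite !dotvE (dotvC w v).
  by field; rewrite gt_eqF.
by apply/seteqP; split=> w H u; have := H u; rewrite !E leeD2rE.
Qed.

Lemma prox_growth f mu : 0 < mu -> (mu%:E < prox_threshold f)%E ->
  exists a C, 0 < a /\ forall w,
    ((a * dotv w w - C)%:E <= f w + ((2 * mu)^-1 * enorm w ^+ 2)%:E)%E.
Proof.
move=> mu0 /ereal_sup_gt[_ [l [l0 [x xl]] <-]]; rewrite lte_fin => mul.
have [c cl] : exists c : R, (c%:E <= moreau_env l f x)%E.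
  move: xl; case: moreau_env => [r| |]// _; first by exists r.
  by exists 0; rewrite leey.
have lt_inv : (2 * l)^-1 < (2 * mu)^-1.
  by rewrite ltf_pV2 ?posrE ?mulr_gt0// ltr_pM2l.
have B0 : 0 < (2 * l)^-1 by rewrite invr_gt0 mulr_gt0.
move: lt_inv B0; set A := (2 * mu)^-1; set B := (2 * l)^-1 => BA B0.
(* The envelope bound yields [f w >= c - B |w - x|^2], so adding [A |w|^2] leaves the coefficient
   [A - B > 0]. Half of it absorbs the cross term [- <u, w>] by Young's inequality. *)
pose a := (A - B) / 2.
have a0 : 0 < a by rewrite divr_gt0// subr_gt0.
pose u := - (2 * B) *: x.
exists a, (B * dotv x x + (2 * (a * 2))^-1 * dotv u u - c).
split=> // w.
have : (c%:E <= prox_objective l f x w)%E.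
  by apply: le_trans cl _; apply: ereal_inf_lbound; exists w.
have := dotv_young w u (mulr_gt0 a0 (ltr0n _ 2)).
set Q := _^-1 * dotv u u; rewrite /prox_objective !sqr_enorm -/B.
case: (f w) => [r| |]; rewrite ?addye ?leey//.
rewrite -!EFinD !lee_fin /u !dotvE (dotvC x w) /a; lra.
Qed.

Lemma growth_coercive h a (C : R) : 0 < a ->
  (forall w, ((a * dotv w w - C)%:E <= h w)%E) -> coercive h.
Proof.
move=> a0 hg; rewrite /coercive limf_einfE; apply: eq_infty => r.
(* Beyond [M], [a |x| > |r| + |C|], while [|x| > 1] gives [|C| / |x| <= |C|]; hence
   [(a |x|^2 - C) / |x| >= r]. *)
pose M := Num.max 1 ((`|r| + `|C|) / a).
apply: (@le_trans _ _ (ereal_inf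
  ((fun x => (h x * (enorm x)^-1%:E)%E) @` [set x | M < enorm x]))); last first.
  by apply: ereal_sup_ubound; exists [set x | M < enorm x] => //; exists M.
apply/ereal_infP => _ [x /= + <-].
rewrite gt_max ltr_pdivrMr// => /andP[x1 xr].
have x0 : 0 < enorm x by lra.
apply: (@le_trans _ _ ((a * dotv x x - C) * (enorm x)^-1)%:E); last first.
  by rewrite EFinM lee_wpmul2r// lee_fin invr_ge0 ltW.
rewrite lee_fin ler_pdivlMr// -sqr_enorm.
have := ler_norm r; have := ler_norm C; have := normr_ge0 C; nra.
Qed.

End Minimizers.

Theorem proposition4p6 (R : realType) (n : nat) (f : 'rV[R]_n -> \bar R)
    (mu : R) (f_proper : proper_fun f) (f_lsc : lower_semicontinuous f)
    (f_pb : prox_bounded f) (threshold_gt0 : (0 < prox_threshold f)%E)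
    (mu_gt0 : 0 < mu) (mu_lt : (mu%:E < prox_threshold f)%E) :
  single_valued (Prox mu f) <->
  (essentially_strictly_convex
     (fun x => (f x + ((2 * mu)^-1 * enorm x ^+ 2)%:E)%E) /\
   coercive (fun x => (f x + ((2 * mu)^-1 * enorm x ^+ 2)%:E)%E)).
Proof.
set h := (fun x => _)%E.
have [a [C [a0 hg]]] := prox_growth mu_gt0 mu_lt.
have h_lsc : lower_semicontinuous h.
  apply: lower_semicontinuousD => //; under eq_fun do rewrite sqr_enorm.
  by move=> x; apply: (@cvgM _ _ (nbhs x));
    [exact: cvg_cst|exact: continuous_dotvv].
have h_proper : proper_fun h.
  split=> [x|]; first by apply: lt_le_trans (hg x); exact: ltNyr.
  have [x fx] := f_proper.2; exists x; rewrite /h.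
  by rewrite lte_add_pinfty// ltry.
split=> [Prox1|[hesc _] x].
  have hu v : exists q, argmin (tilt h v) = [set q].
    by have [q] := Prox1 (mu *: v); rewrite prox_argmin//; exists q.
  have [p pE] := choice hu.
  split; last exact: growth_coercive hg.
  split=> //; first exact: unique_argmin_convex hg pE.
  by move=> D; exact: unique_argmin_strict.
(* Every point has the form [mu v], so its proximal set is the set of minimizers of a tilt. *)
pose v := mu^-1 *: x.
have -> : x = mu *: v by rewrite scalerA divff ?gt_eqF// scale1r.
rewrite prox_argmin//.
have [||p vp] := growth_argmin (@lower_semicontinuous_tilt _ _ h v h_lsc) _ _
  (tilt_growth v a0 hg).
- have [w hw] := h_proper.2; exists w; rewrite /tilt; move: hw.
  by case: (h w) => // r _; rewrite -EFinD ltry.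
- by rewrite divr_gt0.
exists p; apply/seteqP; split=> q; last by move=> ->.
by move=> vq; exact: argmin_tilt_unique hesc vq vp.
Qed.
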